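(* Let $f$ be a continuous real-valued function on $[0,\infty)$. For $0\le p\le 1\le q$, suppose that one of the following inequalities holds for all non-negative numbers $a\le b$: (i) $f(\sqrt{ab})\le f\left(\left(\frac{a^p+b^p}{2}\right)^{1/p}\right)$; (ii) $f\left(\left(\frac{a^p+b^p}{2}\right)^{1/p}\right)\le f\left(\frac{a+b}{2}\right)$; (iii) $f\left(\frac{a+b}{2}\right)\le f\left(\left(\frac{a^q+b^q}{2}\right)^{1/q}\right)$. Then the function $f$ is increasingly monotone on $[0,\infty)$, i.e. $f(x)\le f(y)$ whenever $0\le x\le y$.
   Context: For $p=0$ the expression $\left(\frac{a^p+b^p}{2}\right)^{1/p}$ is interpreted as its limit as $p\to 0^+$, namely $\sqrt{ab}$.
   Formalization: The formal theorem requires p > 0 in (i), p < 1 in (ii) and q > 1 in (iii); at the excluded endpoints the inequality is trivially an equality for every f, e.g. f(x) = -x, so the claim fails there. *)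

(* Defs.v *)
From HB Require Import structures.
From mathcomp Require Import all_boot all_order all_algebra.
From mathcomp Require Import all_classical all_reals all_analysis.
Set Implicit Arguments.
Unset Strict Implicit.
Unset Printing Implicit Defensive.
Import Order.TTheory GRing.Theory Num.Theory.
Import numFieldNormedType.Exports.
Local Open Scope classical_set_scope.
Local Open Scope ring_scope.

(* Meant for p, a, b >= 0. At p = 0 the value is the limit as p -> 0+; the
   general formula would give 1 there, since 0^-1 = 0 and x `^ 0 = 1. For
   p > 0 the convention 0 `^ p = 0 makes the formula correct when a or b
   vanishes. *)
Definition power_mean (R : realType) (p a b : R) : R :=
  if p == 0 then Num.sqrt (a * b)
  else ((a `^ p + b `^ p) / 2) `^ p^-1.

(* Main.v *)
Require Import Defs.
From HB Require Import structures.
From mathcomp Require Import all_boot all_order all_algebra.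
From mathcomp Require Import all_classical all_reals all_analysis.
From mathcomp Require Import ring lra.
Set Implicit Arguments.
Unset Strict Implicit.
Unset Printing Implicit Defensive.
Import Order.TTheory GRing.Theory Num.Theory.
Import numFieldNormedType.Exports.
Local Open Scope classical_set_scope.
Local Open Scope ring_scope.

(* All three inequalities read f (M_p a b) <= f (M_q a b) with p < q, where M_p
   is the power mean.  For 0 < c < d, homogeneity lets us scale a pair with
   b / a = d / c so that M_p a b = c; since a <= M_p < M_q <= b, the value
   M_q a b lies in ]c, d] and f c <= f (M_q a b).  If 0 < x < y and f y < f x,
   taking for c the last point of [x, y] where f >= f x contradicts this with
   d = y.  The case x = 0 follows by continuity. *)

(** Continuity within [A] only makes the preimage closed relative to [A]; since [A] is itself
    closed, it is closed in the whole space. *)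
Lemma closed_within_preimage (T U : topologicalType) (A : set T) (B : set U)
    (f : T -> U) :
  closed A -> {within A, continuous f} -> closed B -> closed (A `&` f @^-1` B).
Proof.
move=> Acl fc Bcl; rewrite closed_setSI//.
by move/continuous_closedP: fc; exact.
Qed.

Section RealAnalysis.
Variable R : realType.
Implicit Types (f : R -> R) (a b c d p q r s x y z : R).

Lemma closed_sup (A : set R) :
  A !=set0 -> has_ubound A -> closed A -> A (sup A).
Proof. by move=> A0 uA Acl; rewrite {1}(closure_id A).1//; exact: closure_sup. Qed.

Lemma closed_inf (A : set R) :
  A !=set0 -> has_lbound A -> closed A -> A (inf A).
Proof.
move=> A0 lA Acl; apply: (itv_closed_infimums A0 Acl).
by split=> [z /(ge_inf lA)//|z zA]; exact: lb_le_inf.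
Qed.

Lemma nondecreasing_of_right_le f :
  {within `[0, +oo[, continuous f} ->
  (forall c d, 0 < c -> c < d -> exists2 z, c < z <= d & f c <= f z) ->
  forall x y, 0 <= x -> x <= y -> f x <= f y.
Proof.
move=> fc step.
have itvcl : closed (`[0, +oo[%classic : set R) by exact: interval_closed.
have pos x y : 0 < x -> x <= y -> f x <= f y.
  move=> x0 xy; rewrite leNgt; apply/negP => fyx.
  pose A := (`[0, +oo[ `&` f @^-1` [set v | f x <= v]) `&` `[x, y].
  have Acl : closed A.
    apply: closedI; last exact: interval_closed.
    exact: closed_within_preimage itvcl fc (@closed_ge _ _).
  have Ax : A x.
    split; last by rewrite /= in_itv/= lexx.
    by split; rewrite /= ?in_itv/= ?andbT ?(ltW x0).
  have uA : has_ubound A by exists y => z [_]; rewrite /= in_itv/= => /andP[].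
  have [[_ fxc]] : A (sup A) by apply: closed_sup => //; exists x.
  rewrite /= in_itv/= => /andP[xc]; rewrite le_eqVlt => /predU1P[cy|cy].
    by move: fyx; rewrite -cy ltNge fxc.
  (* This [z] satisfies [f x <= f (sup A) <= f z], so it is a point of [A] beyond its supremum. *)
  have [z /andP[cz zy] fcz] := step _ _ (lt_le_trans x0 xc) cy.
  have xz : x <= z by rewrite (le_trans xc)// ltW.
  suff /(ub_le_sup uA) : A z by rewrite leNgt cz.
  split; last by rewrite /= in_itv/= xz.
  by split; rewrite /= ?(le_trans fxc)// in_itv/= andbT (le_trans (ltW x0)).
move=> x y; rewrite le_eqVlt => /predU1P[<-|]; last exact: pos.
rewrite le_eqVlt => /predU1P[<-//|y0].
(* Case [x = 0]: this closed set contains []0, y]] by the positive case, so its infimum, which it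
   contains, has to be 0. *)
pose A := `[0, +oo[ `&` f @^-1` [set v | v <= f y].
have Acl : closed A := closed_within_preimage itvcl fc (@closed_le _ _).
have Az z : 0 < z -> z <= y -> A z.
  by move=> z0 zy; split; rewrite /= ?pos// in_itv/= ltW.
have lA : has_lbound A by exists 0 => z []; rewrite /= in_itv/= andbT.
have [] : A (inf A) by apply: closed_inf => //; exists y; exact: Az.
rewrite /= in_itv/= andbT le_eqVlt => /predU1P[<-//|i0 _].
(* If [inf A] were positive, its half, capped at [y], would be a smaller point of [A]. *)
have : inf A <= Num.min (inf A / 2) y.
  by apply: ge_inf => //; apply: Az; rewrite ?ge_min ?lexx ?orbT// lt_min y0 divr_gt0.
by rewrite le_min => /andP[]; lra.
Qed.

Lemma ln_ltB1 x : 0 < x -> x != 1 -> ln x < x - 1.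
Proof.
move=> x0 x1; rewrite -ltr_expR lnK//.
by have := @expR_gt1Dx R (x - 1); rewrite subr_eq0 addrC subrK; exact.
Qed.

(** Strict Bernoulli inequality. With [w] the right-hand side, apply [ln u <= u - 1] at [u = x / w]
    and [u = 1 / w] with weights [r] and [1 - r]: the bounds add up to 0, leaving
    [r * ln x < ln w]. *)
Lemma powR_lt_tangent r x : 0 < r < 1 -> 0 < x -> x != 1 ->
  x `^ r < 1 + r * (x - 1).
Proof.
move=> /andP[r0 r1] x0 x1; set w := 1 + _.
have w0 : 0 < w by rewrite /w; nra.
(* This makes the bound at [x / w] strict, which is enough for the weighted sum. *)
have xw : x / w != 1.
  apply: contra x1 => /eqP xw1.
  have xw : x = w by rewrite -[LHS](divfK (lt0r_neq0 w0)) xw1 mul1r.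
  have : (1 - r) * (x - 1) = 0 by rewrite mulrBl mul1r {1}xw /w; ring.
  move/eqP; rewrite mulf_eq0 !subr_eq0 => /orP[/eqP rE|//].
  by rewrite -rE ltxx in r1.
rewrite -ltr_ln ?posrE ?powR_gt0// ln_powR.
have := ln_ltB1 (divr_gt0 x0 w0) xw; rewrite ln_div ?posrE// => h1.
have := @le_ln1Dx R (w^-1 - 1).
rewrite [1 + _]addrC subrK lnV ?posrE// ltrBrDr addNr invr_gt0 => /(_ w0) h2.
have e : r * (x / w - 1) + (1 - r) * (w^-1 - 1) = 0.
  by rewrite /w; field; rewrite -/w gt_eqF.
have {}h1 : r * (ln x - ln w) < r * (x / w - 1) by rewrite ltr_pM2l.
have {}h2 : (1 - r) * - ln w <= (1 - r) * (w^-1 - 1).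
  by rewrite ler_pM2l// subr_gt0.
lra.
Qed.

(** Strict concavity: both points lie strictly below the tangent at the midpoint [m], obtained from
    the tangent at 1 by scaling. The linear terms cancel in the sum because [a - m] and [b - m] are
    opposite. *)
Lemma powR_midpoint_lt r a b : 0 < r < 1 -> 0 < a -> 0 < b -> a != b ->
  (a `^ r + b `^ r) / 2 < ((a + b) / 2) `^ r.
Proof.
move=> r01 a0 b0 ab; set m := (a + b) / 2.
have m0 : 0 < m by rewrite divr_gt0 ?addr_gt0.
have tangent x : 0 < x -> x != m -> x `^ r < m `^ r * (1 + r * (x / m - 1)).
  move=> x0 xm; rewrite -{1}(divfK (lt0r_neq0 m0) x) mulrC.
  rewrite powRM ?(ltW m0) ?(ltW (divr_gt0 x0 m0))//.
  rewrite ltr_pM2l; last exact: powR_gt0.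
  apply: powR_lt_tangent => //; first exact: divr_gt0.
  by apply: contra_neq xm => xm; rewrite -(divfK (lt0r_neq0 m0) x) xm mul1r.
have am : a != m by apply: contra_neq ab; rewrite /m; lra.
have bm : b != m by apply: contra_neq ab; rewrite /m; lra.
have := ltrD (tangent _ a0 am) (tangent _ b0 bm).
have -> : m `^ r * (1 + r * (a / m - 1)) + m `^ r * (1 + r * (b / m - 1)) = m `^ r * 2.
  by rewrite /m; field; rewrite gt_eqF ?addr_gt0.
by rewrite -ltr_pdivrMr.
Qed.

Lemma sqrtM_lt_mid a b : 0 <= a -> 0 <= b -> a != b ->
  Num.sqrt (a * b) < (a + b) / 2.
Proof.
move=> a0 b0 ab; rewrite -ltr_sqr ?nnegrE ?sqrtr_ge0 ?divr_ge0 ?addr_ge0//.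
rewrite sqr_sqrtr ?mulr_ge0// -subr_gt0.
have -> : ((a + b) / 2) ^+ 2 - a * b = ((a - b) / 2) ^+ 2 by field.
by rewrite exprn_even_gt0//= mulf_neq0 ?subr_eq0// invr_eq0.
Qed.

Lemma powRK r a : r != 0 -> 0 <= a -> (a `^ r) `^ r^-1 = a.
Proof. by move=> r0 a0; rewrite -powRrM divff// powRr1. Qed.

Lemma powR_ltl r a b : 0 < r -> 0 <= a -> a < b -> a `^ r < b `^ r.
Proof.
by move=> r0 a0 ab; apply: gt0_ltr_powR; rewrite ?nnegrE// (le_trans a0)// ltW.
Qed.

Lemma powR_lel r a b : 0 <= r -> 0 <= a -> a <= b -> a `^ r <= b `^ r.
Proof.
by move=> r0 a0 ab; apply: ge0_ler_powR; rewrite ?nnegrE// (le_trans a0).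
Qed.

Lemma power_meanM p s a b : 0 <= s -> 0 <= a -> 0 <= b ->
  power_mean p (s * a) (s * b) = s * power_mean p a b.
Proof.
move=> s0 a0 b0; rewrite /power_mean; case: eqP => [_|/eqP p0].
  have -> : s * a * (s * b) = s ^+ 2 * (a * b) by ring.
  by rewrite sqrtrM ?sqr_ge0// sqrtr_sqr ger0_norm.
rewrite (powRM _ s0 a0) (powRM _ s0 b0) -mulrDr -mulrA powRM ?powR_ge0 ?divr_ge0 ?addr_ge0 ?powR_ge0//.
by rewrite powRK.
Qed.

Lemma power_mean_ge p a b : 0 <= p -> 0 <= a -> a <= b -> a <= power_mean p a b.
Proof.
move=> p0 a0 ab; rewrite /power_mean; case: eqP => [_|/eqP pN0].
  by rewrite -[leLHS]ger0_norm// -sqrtr_sqr ler_wsqrtr// expr2 ler_wpM2l.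
rewrite -[leLHS](powRK pN0)//; apply: powR_lel; rewrite ?invr_ge0 ?powR_ge0//.
by have := powR_lel p0 a0 ab; lra.
Qed.

Lemma power_mean_le p a b : 0 <= p -> 0 <= a -> a <= b -> power_mean p a b <= b.
Proof.
move=> p0 a0 ab; have b0 := le_trans a0 ab.
rewrite /power_mean; case: eqP => [_|/eqP pN0].
  by rewrite -[leRHS]ger0_norm// -sqrtr_sqr ler_wsqrtr// expr2 ler_wpM2r.
rewrite -[leRHS](powRK pN0)//.
apply: powR_lel; rewrite ?invr_ge0 ?divr_ge0 ?addr_ge0 ?powR_ge0//.
by have := powR_lel p0 a0 ab; lra.
Qed.

(** The substitution of [a]^ q[and]b [^ q] for [a] and [b] reduces the claim to the strict
    inequality between geometric and arithmetic means when [p = 0], and to strict concavity of the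
    power [p / q < 1] otherwise. *)
Lemma power_mean_lt p q a b : 0 <= p -> p < q -> 0 < a -> a < b ->
  power_mean p a b < power_mean q a b.
Proof.
move=> p0 pq a0 ab; have b0 := lt_trans a0 ab; have q0 := le_lt_trans p0 pq.
have abq : a `^ q != b `^ q by rewrite lt_eqF// powR_ltl// ltW.
rewrite /power_mean (gt_eqF q0); case: eqP => [_|/eqP pN0].
  rewrite -[ltLHS](@powRK q) ?gt_eqF ?sqrtr_ge0//.
  rewrite powR_ltl ?invr_gt0 ?powR_ge0//.
  (* Writing the root as a power 1/2 lets it commute with the power [q]. *)
  rewrite -powR12_sqrt ?mulr_ge0 ?ltW// powRAC powRM ?ltW//.
  by rewrite powR12_sqrt ?mulr_ge0 ?powR_ge0// sqrtM_lt_mid ?powR_ge0.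
have {}p0 : 0 < p by rewrite lt_neqAle eq_sym pN0.
have pqE x : x `^ p = (x `^ q) `^ (p / q) by rewrite -powRrM mulrC divfK ?gt_eqF.
have -> : q^-1 = p / q * p^-1 by field; rewrite !gt_eqF.
rewrite [ltRHS]powRrM; apply: powR_ltl; rewrite ?invr_gt0 ?divr_ge0 ?addr_ge0 ?powR_ge0//.
rewrite !pqE powR_midpoint_lt ?powR_gt0// divr_gt0//=.
by rewrite ltr_pdivrMr// mul1r.
Qed.

Lemma power_mean0 a b : power_mean 0 a b = Num.sqrt (a * b).
Proof. by rewrite /power_mean eqxx. Qed.

Lemma power_mean1 a b : 0 <= a -> 0 <= b -> power_mean 1 a b = (a + b) / 2.
Proof.
by move=> a0 b0; rewrite /power_mean oner_eq0 invr1 !powRr1 ?divr_ge0 ?addr_ge0.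
Qed.

Lemma nondecreasing_of_power_mean f p q :
  {within `[0, +oo[, continuous f} -> 0 <= p -> p < q ->
  (forall a b, 0 <= a -> a <= b -> f (power_mean p a b) <= f (power_mean q a b)) ->
  forall x y, 0 <= x -> x <= y -> f x <= f y.
Proof.
move=> fc p0 pq fpq; apply: nondecreasing_of_right_le => // c d c0 cd.
have q0 : 0 <= q by rewrite (le_trans p0)// ltW.
(* The scaled pair is [(s, s * t)]; dividing by the mean [m] of [(1, t)] in [s = c / m] makes its
   [p]-mean equal to [c]. *)
pose t := d / c; have t1 : 1 < t by rewrite ltr_pdivlMr// mul1r.
have m1 := power_mean_ge p0 ler01 (ltW t1); set m := power_mean p 1 t in m1.
have m0 : 0 < m := lt_le_trans ltr01 m1.
pose s := c / m; have s0 : 0 < s by rewrite divr_gt0.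
have t0 : 0 <= t by rewrite (le_trans ler01)// ltW.
have sM r : power_mean r s (s * t) = s * power_mean r 1 t.
  by have := power_meanM r (ltW s0) ler01 t0; rewrite mulr1.
have cE : c = power_mean p s (s * t) by rewrite sM divfK ?gt_eqF.
have sst : s < s * t by rewrite ltr_pMr.
exists (power_mean q s (s * t)); last by rewrite {1}cE fpq// ltW.
rewrite {1}cE power_mean_lt//=.
apply: le_trans (power_mean_le q0 (ltW s0) (ltW sst)) _.
(* The larger entry of the pair does not exceed [d] because [m >= 1]. *)
have -> : s * t = d / m by rewrite /s /t; field; rewrite !gt_eqF.
by rewrite ler_pdivrMr// ler_peMr// ltW// (lt_trans c0).
Qed.

End RealAnalysis.

Theorem theorem1 (R : realType) (f : R -> R) (p q : R)
    (f_cont : {within `[0, +oo[, continuous f})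
    (p_ge0 : 0 <= p) (p_le1 : p <= 1) (q_ge1 : 1 <= q)
    (f_means :
      [\/ 0 < p /\ (forall a b : R, 0 <= a -> a <= b ->
            f (Num.sqrt (a * b)) <= f (power_mean p a b)),
          p < 1 /\ (forall a b : R, 0 <= a -> a <= b ->
            f (power_mean p a b) <= f ((a + b) / 2))
        | 1 < q /\ (forall a b : R, 0 <= a -> a <= b ->
            f ((a + b) / 2) <= f (power_mean q a b))]) :
  forall x y : R, 0 <= x -> x <= y -> f x <= f y.
Proof.
(* The three cases compare the means of exponents [(0, p)], [(p, 1)] and [(1, q)], and [lt_means]
   says that the two exponents differ. *)
case: f_means => -[lt_means fle].
- apply: nondecreasing_of_power_mean f_cont (lexx 0) lt_means _ => a b a0 ab.
  by rewrite power_mean0; exact: fle.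
- apply: nondecreasing_of_power_mean f_cont p_ge0 lt_means _ => a b a0 ab.
  by rewrite power_mean1 ?(le_trans a0)//; exact: fle.
- apply: nondecreasing_of_power_mean f_cont ler01 lt_means _ => a b a0 ab.
  by rewrite power_mean1 ?(le_trans a0)//; exact: fle.
Qed.
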